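(* Let $f:\mathbb{R}^n\to\mathbb{R}_+$ be differentiable with Lipschitz continuous gradient (with Lipschitz constant $L_f>0$), let $\lambda>0$, and let $\psi:\mathbb{R}_+\to\mathbb{R}_+$ and $\Omega\subseteq\mathbb{R}^n_+$ satisfy Assumption A (see context), with $\phi:=\psi^{-1}$. Consider the problem $$\min_{x\in\mathbb{R}^n}\ F(x):=f(x)+\lambda\sum_{i=1}^n\psi(|x_i|)+\delta_\Omega(|x|).$$ Then any global minimizer $x^*$ of this problem satisfies the $\psi_{\rm opt}$-stationarity condition, i.e., there exist $\eta_*>0$ and $\alpha^*\in\{-1,1\}^n$ such that $$x^*\in\operatorname*{Arg\,min}_{|x|\in\Omega}\left\{\frac{\eta_*}{2}\|\psi(|x|)-\psi(|x^*|)\|^2+\sum_{i=1}^n\big[\lambda+\alpha_i^*\cdot\nabla_i f(x^* )\cdot\phi'_+(\psi(|x_i^*|))\big]\cdot\psi(|x_i|)\right\},$$ where $\alpha_i^*=\operatorname{sgn}(x_i^* )$ whenever $x_i^*\neq 0$, and $\alpha_i^*=-\operatorname{sgn}(\nabla_i f(x^* ))$ whenever $x_i^*=0$ and $\nabla_i f(x^* )\neq 0$.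
   Context: Notation: $\mathbb{R}_+=[0,\infty)$. For $x\in\mathbb{R}^n$, $|x|$ is the componentwise absolute value; $\|\cdot\|$ is the Euclidean norm; $\nabla_i f$ is the $i$-th entry of $\nabla f$; $\operatorname{sgn}(t)=1$ if $t\ge 0$ and $\operatorname{sgn}(t)=-1$ if $t<0$. $\delta_\Omega$ is the indicator function of $\Omega$ ($0$ on $\Omega$, $+\infty$ outside). For $y\in\mathbb{R}^n_+$, $\psi(y)$ and $\phi(y)$ denote the vectors with entries $\psi(y_i)$ and $\phi(y_i)$. For $h:\mathbb{R}_+\to\mathbb{R}$, $h'_+(t):=\lim_{s\downarrow0}\frac{h(t+s)-h(t)}{s}$ is the right-hand derivative. $\operatorname{Arg\,min}$ denotes the set of all minimizers; $\operatorname{Arg\,min}_{|x|\in\Omega}$ is over all $x\in\mathbb{R}^n$ with $|x|\in\Omega$. Assumption A: (a) $\psi:\mathbb{R}_+\to\mathbb{R}_+$ satisfies $\psi(0)=0$, is continuous and concave, is differentiable on $(0,\infty)$ with $\psi'>0$ there, and $\lim_{t\to\infty}\psi(t)=\infty$. (b) $\phi:=\psi^{-1}$ exists on $\mathbb{R}_+$, and $\phi'_+$ is (finite and) locally Lipschitz continuous on $\mathbb{R}_+$. (c) $\Omega\subseteq\mathbb{R}^n_+$ is a nonempty closed set. *)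

(* Defs.v *)
From HB Require Import structures.
From mathcomp Require Import all_boot all_order all_algebra.
From mathcomp Require Import all_classical all_reals all_analysis.

Set Implicit Arguments.
Unset Strict Implicit.
Unset Printing Implicit Defensive.

Import Order.TTheory GRing.Theory Num.Theory.
Import numFieldNormedType.Exports.

Local Open Scope classical_set_scope.
Local Open Scope ring_scope.

(* Functions on R_+ = [0, +oo[ are represented by total functions R -> R; every
   hypothesis and conclusion below only depends on their values on [0, +oo[. *)

Definition sgn (R : realType) (t : R) : R := if 0 <= t then 1 else -1.

(* The library norm on 'rV[R]_n is the sup norm. *)
Definition enorm (R : realType) (n : nat) (x : 'rV[R]_n) : R :=
  Num.sqrt (\sum_i x 0 i ^+ 2).

Definition vabs (R : realType) (n : nat) (x : 'rV[R]_n) : 'rV[R]_n :=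
  map_mx (fun t => `|t|) x.

Definition grad (R : realType) (n : nat) (f : 'rV[R]_n -> R) (x : 'rV[R]_n) :
  'rV[R]_n := \row_i 'D_(delta_mx 0 i) f x.

Definition indic_ext (R : realType) (T : Type) (A : set T) (x : T) : \bar R :=
  if x \in A then 0%E else +oo%E.

Definition Argmin (d : Order.disp_t) (Y : porderType d) (T : Type) (A : set T)
  (g : T -> Y) : set T := [set x | A x /\ forall y, A y -> (g x <= g y)%O].

Definition concave_function (R : realType) (D : set R) (h : R -> R) :=
  convex_function (D : set R^o) (fun t => - h t).

Definition rquot (R : realType) (h : R -> R) (t : R) : R -> R :=
  fun s => (h (t + s) - h t) / s.

(* [lim] is only meaningful when the right-hand limit exists, i.e. under
   [rderivable h t]. *)
Definition rderivable (R : realType) (h : R -> R) (t : R) : Prop :=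
  cvg (rquot h t s @[s --> 0^'+]).
Definition rderive (R : realType) (h : R -> R) (t : R) : R :=
  lim (rquot h t s @[s --> 0^'+]).

Record assumption_A_a (R : realType) (psi : R -> R) : Prop := AssumptionAa {
  psi_ge0 : forall t : R, 0 <= t -> 0 <= psi t;
  psi_0 : psi 0 = 0;
  psi_continuous : {within `[0, +oo[, continuous psi};
  psi_concave : concave_function `[0, +oo[ psi;
  psi_derivable : forall t : R, 0 < t -> derivable psi t 1;
  psi_derive_gt0 : forall t : R, 0 < t -> 0 < derive1 psi t;
  psi_to_pinfty : psi t @[t --> +oo_R] --> +oo_R
}.

(* [phi] is the inverse of [psi : R_+ -> R_+]. *)
Record assumption_A_b (R : realType) (psi phi : R -> R) : Prop := AssumptionAb {
  phi_ge0 : forall t : R, 0 <= t -> 0 <= phi t;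
  psiK : {in Num.nneg, cancel psi phi};
  phiK : {in Num.nneg, cancel phi psi};
  phi_rderivable : forall t : R, 0 <= t -> rderivable phi t;
  phi_rderive_lipschitz :
    [locally [lipschitz rderive phi t | t in `[0, +oo[%classic]]
}.

Record assumption_A_c (R : realType) (n : nat) (Omega : set 'rV[R]_n) : Prop :=
  AssumptionAc {
  Omega_ge0 : forall v, Omega v -> forall i, 0 <= v 0 i;
  Omega_nonempty : Omega !=set0;
  Omega_closed : closed Omega
}.

Definition objective (R : realType) (n : nat) (f : 'rV[R]_n -> R) (lambda : R)
    (psi : R -> R) (Omega : set 'rV[R]_n) (x : 'rV[R]_n) : \bar R :=
  ((f x + lambda * \sum_i psi `|x 0 i|)%:E + indic_ext R Omega (vabs x))%E.

Definition psi_opt_stationary (R : realType) (n : nat) (f : 'rV[R]_n -> R)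
    (lambda : R) (psi phi : R -> R) (Omega : set 'rV[R]_n) (xs : 'rV[R]_n) :=
  exists (eta : R) (alpha : 'rV[R]_n),
    [/\ 0 < eta,
        forall i, alpha 0 i = -1 \/ alpha 0 i = 1,
        forall i, xs 0 i != 0 -> alpha 0 i = sgn (xs 0 i),
        forall i, xs 0 i = 0 -> grad f xs 0 i != 0 ->
          alpha 0 i = - sgn (grad f xs 0 i) &
        Argmin [set x | Omega (vabs x)]
          (fun x : 'rV[R]_n =>
             eta / 2 * enorm (map_mx psi (vabs x) - map_mx psi (vabs xs)) ^+ 2
             + \sum_i (lambda + alpha 0 i * grad f xs 0 i
                                * rderive phi (psi `|xs 0 i|)) * psi `|x 0 i|)
          xs].

(* Main.v *)
(* Put y = psi(|x|) and ys = psi(|xs|).  For a feasible x, the sign-flipped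
   point z_i = alpha_i |x_i| is also feasible, and z_i - xs_i =
   alpha_i (phi(y_i) - phi(ys_i)).  Since F(xs) <= F(z), the quadratic upper
   bound on f around xs and the first-order expansion of phi at ys with
   quadratic error (phi' is locally Lipschitz) give the claim for y near ys,
   with eta_* of the order of the error constants.  Away from ys a large
   quadratic penalty dominates the linear term outright. *)
Require Import Defs.
From mathcomp Require Import all_boot all_order all_algebra.
From mathcomp Require Import all_classical all_reals all_analysis.
From mathcomp Require Import ring lra.

Set Implicit Arguments.
Unset Strict Implicit.
Unset Printing Implicit Defensive.

Import Order.TTheory GRing.Theory Num.Theory.
Import numFieldNormedType.Exports.

Local Open Scope classical_set_scope.
Local Open Scope ring_scope.

(** The local Lipschitz condition lives on pairs; at the diagonal pair [(t, t)] it gives a product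
    of two neighbourhoods, and the smaller radius serves both arguments. The case [t = 0] is
    included, with a one-sided neighbourhood. *)
Lemma locally_lipschitz_nonneg (R : realType) (h : R -> R) (t : R) :
  [locally [lipschitz h u | u in `[0, +oo[%classic]] -> 0 <= t ->
  exists K d : R, [/\ 0 <= K, 0 < d & forall u v, 0 <= u -> 0 <= v ->
    `|u - t| < d -> `|v - t| < d -> `|h u - h v| <= K * `|u - v|].
Proof.
move=> hL t0.
have tt : (`[0, +oo[%classic `*` `[0, +oo[%classic) (t, t).
  by split; rewrite /= in_itv/= t0.
have [M [Mr MP]] := hL (t, t) tt.
pose K := `|M| + 1.
have MK : M < K by rewrite (le_lt_trans (ler_norm M))// ltrDl.
have := MP K MK.
case => -[A B] /= [/nbhs_ballP[a /= a0 aA] /nbhs_ballP[b /= b0 bB]] AB.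
exists K, (Num.min a b); split.
- by rewrite addr_ge0.
- by rewrite lt_min a0 b0.
move=> u v u0 v0; rewrite !lt_min => /andP[ua ub] /andP[va vb].
apply: (AB (u, v)); first split => /=.
- by apply: aA; rewrite /ball /= distrC.
- by apply: bB; rewrite /ball /= distrC.
by split; rewrite /= in_itv/= ?u0 ?v0.
Qed.

(** * Differentiability and first-order expansion of the inverse [phi] on the half-line *)

Section inverse.
Variables (R : realType) (psi phi : R -> R).
Hypotheses (HAa : assumption_A_a psi) (HAb : assumption_A_b psi phi).

Lemma phi_gt0 (y : R) : 0 < y -> 0 < phi y.
Proof.
move=> y0; rewrite lt_neqAle (phi_ge0 HAb (ltW y0)) andbT.
apply/eqP => p0; have := phiK HAb (x := y).
by rewrite qualifE/= (ltW y0) -p0 (psi_0 HAa) => /(_ isT) yE; rewrite yE ltxx in y0.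
Qed.

Lemma rderive_is_derive (h : R -> R) (t dh : R) :
  is_derive t 1 h dh -> rderive h t = dh.
Proof.
move=> [hd hE]; apply/cvg_lim => //.
have := hd; rewrite /derivable => /cvg_ex[l hl].
apply: (@cvg_trans _ ((fun s => s^-1 *: ((h \o shift t) (s *: 1) - h t)) @ 0^'+)).
  apply: near_eq_cvg; near=> s.
  by rewrite /rquot /= /GRing.scale/= mulr1 mulrC (addrC s).
have lE : l = dh by rewrite -hE; apply/esym/cvg_lim.
by apply: cvg_dnbhs_at_right; rewrite -lE.
Unshelve. all: by end_near. Qed.

(** Inverse function rule at the point [phi y], which is positive, so that [psi] is differentiable
    there with nonzero derivative. The two-sided derivative so obtained must agree with the
    right-hand one. *)
Lemma is_derive_phi (y : R) : 0 < y -> is_derive y 1 phi (rderive phi y).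
Proof.
move=> y0.
have t0 := phi_gt0 y0.
have yE : psi (phi y) = y by apply: (phiK HAb); rewrite qualifE/= ltW.
have := @is_derive_inverse R psi phi (derive1 psi (phi y)) (phi y).
rewrite yE => H.
suff D : is_derive y 1 phi (derive1 psi (phi y))^-1.
  by rewrite (rderive_is_derive D).
apply: H.
- near=> z; apply: (psiK HAb); rewrite qualifE/= ltW//.
  by near: z; exact: lt_nbhsr.
- near=> z; apply/differentiable_continuous/derivable1_diffP.
  by apply: (psi_derivable HAa); near: z; exact: lt_nbhsr.
- by rewrite derive1E; apply/derivableP/(psi_derivable HAa).
- by rewrite gt_eqF// (psi_derive_gt0 HAa).
Unshelve. all: by end_near. Qed.

(** Writes [h s] as the quotient times [s - t], plus [h t]. It supplies continuity of [phi] at 0, an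
    endpoint that [is_derive_phi] does not reach. *)
Lemma rderivable_cvg (h : R -> R) (t : R) : rderivable h t ->
  h s @[s --> t^'+] --> h t.
Proof.
move=> /cvg_ex[l hl].
have shift0 : (s - t) @[s --> t^'+] --> 0^'+.
  move=> A [e /= e0 eA]; exists e => //= s se ts.
  by apply: eA; rewrite ?subr_gt0//= sub0r opprB.
have idt : (s - t) @[s --> t^'+] --> (0 : R).
  exact: (cvg_trans shift0 (cvg_within _)).
have hE : rquot h t (s - t) * (s - t) + h t @[s --> t^'+] --> l * 0 + h t.
  apply: cvgD; last exact: cvg_cst.
  by apply: cvgM => //; exact: cvg_comp shift0 hl.
rewrite mulr0 add0r in hE; apply: cvg_trans hE; apply: near_eq_cvg; near=> s.
by rewrite /rquot addrCA subrr addr0 divfK ?subrK// subr_eq0 gt_eqF.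
Unshelve. all: by end_near. Qed.

(** The mean value theorem turns the increment of [phi] into [rderive phi c * (u - t)] with [c]
    between [u] and [t]; the Lipschitz bound on [rderive phi] near [t] then costs one more factor
    [|u - t|]. *)
Lemma phi_taylor (t : R) : 0 <= t ->
  exists K d : R, [/\ 0 <= K, 0 < d & forall u, 0 <= u -> `|u - t| < d ->
   `|phi u - phi t - rderive phi t * (u - t)| <= K * (u - t) ^+ 2].
Proof.
move=> t0.
have [K [d [K0 d0 KP]]] :=
  locally_lipschitz_nonneg (@phi_rderive_lipschitz _ _ _ HAb) t0.
exists K, d; split => // u u0 ud.
(* Since [a] may be 0, the left endpoint is treated through the right-hand derivative, all other
   points through [is_derive_phi]. *)
have cont a b : 0 <= a -> a < b -> {within `[a, b], continuous phi}.
  move=> a0 ab; apply/continuous_within_itvP => //; split.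
  - move=> x; rewrite in_itv/= => /andP[ax xb].
    apply/differentiable_continuous/derivable1_diffP.
    exact: (@ex_derive _ _ _ _ _ _ _ (is_derive_phi (le_lt_trans a0 ax))).
  - by apply/rderivable_cvg/(phi_rderivable HAb).
  - apply: cvg_at_left_filter.
    apply/differentiable_continuous/derivable1_diffP.
    exact: (@ex_derive _ _ _ _ _ _ _ (is_derive_phi (le_lt_trans a0 ab))).
have mvt a b : 0 <= a -> a < b -> exists2 c, a < c < b &
    phi b - phi a = rderive phi c * (b - a).
  move=> a0 ab.
  have dphi x : x \in `]a, b[ -> is_derive x 1 phi (rderive phi x).
    by rewrite in_itv/= => /andP[ax _]; exact/is_derive_phi/(le_lt_trans a0).
  have [c cab E] := MVT ab dphi (cont _ _ a0 ab).
  by exists c => //; move: cab; rewrite in_itv.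
have [c [c0 cd E]] : exists c, [/\ 0 <= c, `|c - t| <= `|u - t| &
    phi u - phi t = rderive phi c * (u - t)].
  have [ut|tu|->] := ltgtP u t.
  - have [c /andP[uc ct] E] := mvt _ _ u0 ut.
    exists c; split; first lra.
      by rewrite !ltr0_norm ?subr_lt0//; lra.
    by rewrite -opprB E; ring.
  - have [c /andP[tc cu] E] := mvt _ _ t0 tu.
    exists c; split => //; first lra.
    by rewrite !gtr0_norm ?subr_gt0//; lra.
  - by exists t; split => //; rewrite ?subrr ?mulr0.
rewrite E -mulrBl normrM -real_normK ?num_real// expr2 mulrA.
apply: ler_wpM2r => //.
rewrite (le_trans (KP c t _ _ _ _))// ?(le_lt_trans cd)// ?subrr ?normr0//.
exact: ler_wpM2l.
Qed.

End inverse.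

(** Passes from a lower bound valid only in the box [|e i| < d i] to one valid for all [e], with a
    single [eta] chosen before [e]. *)
Lemma quadratic_penalty (R : realType) (n : nat) (c d : 'I_n -> R) (P : R) :
  (forall i, 0 < d i) -> exists2 eta : R, 0 < eta & forall e : 'I_n -> R,
    ((forall i, `|e i| < d i) ->
       0 <= \sum_i c i * e i + P * \sum_i e i ^+ 2) ->
    0 <= eta / 2 * \sum_i e i ^+ 2 + \sum_i c i * e i.
Proof.
move=> d0; pose B := \sum_i c i ^+ 2; pose W := \sum_i (d i ^+ 2)^-1.
have B0 : 0 <= B by apply: sumr_ge0 => i _; exact: sqr_ge0.
have W0 : 0 <= W by apply: sumr_ge0 => i _; rewrite invr_ge0 sqr_ge0.
(* In [eta / 2], the term [|P|] settles the case of [e] in the box; 1 and [B * W] settle the case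
   where some [|e j|] is at least [d j], because then [W * S >= 1]. *)
exists (2 * (1 + `|P| + B * W)).
  by rewrite mulr_gt0// ltr_wpDr ?mulr_ge0// ltr_wpDr.
move=> e eP; set S := \sum_i e i ^+ 2 in eP *; set T := \sum_i c i * e i in eP *.
have S0 : 0 <= S by apply: sumr_ge0 => i _; exact: sqr_ge0.
rewrite (_ : 2 * _ / 2 = 1 + `|P| + B * W); last by field.
have [near_e|] := boolP [forall i, `|e i| < d i].
  have : P * S <= `|P| * S by rewrite ler_wpM2r// ler_norm.
  have : 0 <= B * W * S by rewrite !mulr_ge0.
  have := eP (fun i => forallP near_e i); lra.
(* AM-GM: |sum c_i e_i| <= B + S, and S >= d_j^2 lets B be absorbed in B W S. *)
rewrite negb_forall => /existsP[j]; rewrite -leNgt => dj.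
have BS : B <= B * W * S.
  rewrite -mulrA ler_peMr//.
  have dW : (d j ^+ 2)^-1 <= W.
    by rewrite /W (bigD1 j)//= lerDl; apply: sumr_ge0 => i _; rewrite invr_ge0 sqr_ge0.
  have dS : d j ^+ 2 <= S.
    rewrite /S (bigD1 j)//= (le_trans (y := e j ^+ 2))//.
      by rewrite -(real_normK (num_real (e j))) lerXn2r ?nnegrE// ltW.
    by rewrite lerDl; apply: sumr_ge0 => i _; exact: sqr_ge0.
  have := ler_pM _ _ dW dS; rewrite invr_ge0 sqr_ge0 mulVf ?gt_eqF ?exprn_gt0//.
  by apply.
have BST : 0 <= B + S + T.
  rewrite /B /S /T -!big_split/=; apply: sumr_ge0 => i _.
  by have := sqr_ge0 (c i + e i / 2); have := sqr_ge0 (e i); nra.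
have : 0 <= `|P| * S by rewrite mulr_ge0.
lra.
Qed.

Section descent.
Variables (R : realType) (n : nat).
Implicit Types (f : 'rV[R]_n -> R) (x v : 'rV[R]_n).

Lemma enorm_sqr x : enorm x ^+ 2 = \sum_i x 0 i ^+ 2.
Proof. by rewrite sqr_sqrtr// sumr_ge0// => i _; exact: sqr_ge0. Qed.

Lemma coord_le_enorm x i : `|x 0 i| <= enorm x.
Proof.
rewrite -sqrtr_sqr ler_wsqrtr// (bigD1 i)//= lerDl.
by apply: sumr_ge0 => j _; exact: sqr_ge0.
Qed.

Lemma derive_grad f x v : differentiable f x ->
  'D_v f x = \sum_i v 0 i * grad f x 0 i.
Proof.
move=> fx; rewrite deriveE// [v in LHS]row_sum_delta linear_sum.
by apply: eq_bigr => i _; rewrite linearZ/= /grad mxE deriveE.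
Qed.

(** The difference quotient of the restriction to the line is, as a function of the increment, the
    one defining the directional derivative. *)
Lemma is_derive_line f x v (s : R) : differentiable f (x + s *: v) ->
  is_derive s 1 (fun r : R => f (x + r *: v)) ('D_v f (x + s *: v)).
Proof.
move=> fd; have := @diff_derivable _ _ _ _ _ v fd.
have E : (fun h : R => h^-1 *: (((fun r : R => f (x + r *: v)) \o shift s) (h *: (1 : R))
             - f (x + s *: v))) =
    (fun h : R => h^-1 *: ((f \o shift (x + s *: v)) (h *: v) - f (x + s *: v))).
  apply/funext => h /=; congr (_ *: (f _ - _)).
  by rewrite [h *: 1]mulr1 scalerDl addrCA.
by move=> fv; split; rewrite /derivable /derive E.
Qed.

(** Mean value theorem on the segment from [x] to [x + v], then the Lipschitz bound on the gradient
    one coordinate at a time. Summing [n] equal coordinate bounds produces the factor [n] in place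
    of the sharp constant 1/2. *)
Lemma descent_bound f (L : R) x v : 0 <= L -> (forall y, differentiable f y) ->
  (forall y z, enorm (grad f y - grad f z) <= L * enorm (y - z)) ->
  f (x + v) <= f x + \sum_i grad f x 0 i * v 0 i
               + n%:R * L * \sum_i v 0 i ^+ 2.
Proof.
move=> L0 fd fL; pose h r := f (x + r *: v).
have hD (s : R) := is_derive_line (fd (x + s *: v)).
have hC : {within `[0, 1], continuous h}.
  apply: derivable_within_continuous => s _.
  exact: (@ex_derive _ _ _ _ _ _ _ (hD s)).
have [c c01 E] := MVT ltr01 (fun s _ => hD s) hC.
move: E; rewrite /h scale1r scale0r addr0 subr0 mulr1 derive_grad//.
move/eqP; rewrite subr_eq => /eqP ->.
rewrite addrC -addrA lerD2l -lerBlDl -sumrB -enorm_sqr.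
have c_le1 : `|c| <= 1.
  by move: c01; rewrite in_itv/= => /andP[c0 c1]; rewrite gtr0_norm// ltW.
have enc : enorm (c *: v) <= enorm v.
  rewrite ler_wsqrtr//; apply: ler_sum => i _.
  rewrite mxE exprMn ler_piMl ?sqr_ge0//.
  by rewrite -(real_normK (num_real c)) exprn_ile1.
have bound i : v 0 i * grad f (x + c *: v) 0 i - grad f x 0 i * v 0 i
    <= L * enorm v ^+ 2.
  rewrite mulrC -mulrBl (le_trans (ler_norm _))// normrM expr2 mulrA.
  apply: ler_pM => //; last exact: coord_le_enorm.
  have -> : grad f (x + c *: v) 0 i - grad f x 0 i
      = (grad f (x + c *: v) - grad f x) 0 i by rewrite !mxE.
  rewrite (le_trans (coord_le_enorm _ _))// (le_trans (fL _ _))//.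
  by rewrite addrAC subrr add0r ler_wpM2l.
rewrite (le_trans (ler_sum _ (fun i _ => bound i)))//.
by rewrite sumr_const card_ord -mulrA mulr_natl.
Qed.

End descent.

Theorem theorem3p1 (R : realType) (n : nat) (f : 'rV[R]_n -> R) (Lf lambda : R)
    (psi phi : R -> R) (Omega : set 'rV[R]_n)
    (f_ge0 : forall x, 0 <= f x)
    (f_diff : forall x, differentiable f x)
    (Lf_gt0 : 0 < Lf)
    (f_lip : forall x y, enorm (grad f x - grad f y) <= Lf * enorm (x - y))
    (lambda_gt0 : 0 < lambda)
    (HAa : assumption_A_a psi)
    (HAb : assumption_A_b psi phi)
    (HAc : assumption_A_c Omega)
    (xs : 'rV[R]_n) :
  Argmin setT (objective f lambda psi Omega) xs ->
  psi_opt_stationary f lambda psi phi Omega xs.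
Proof.
move=> [_ xs_min].
have sgnP (t : R) : sgn t = -1 \/ sgn t = 1 by rewrite /sgn; case: ifP; [right|left].
have sgn_norm (t : R) : t = sgn t * `|t|.
  rewrite /sgn; case: ifPn => [t0|]; first by rewrite mul1r ger0_norm.
  by rewrite -ltNge => t0; rewrite ltr0_norm// mulrNN mul1r.
pose g := grad f xs.
(* Where [xs 0 i] and [g 0 i] both vanish the sign is free; this formula gives -1. *)
pose alpha := \row_i if xs 0 i != 0 then sgn (xs 0 i) else - sgn (g 0 i).
have alphaP i : alpha 0 i = -1 \/ alpha 0 i = 1.
  rewrite mxE; case: ifP => _; first exact: sgnP.
  by case: (sgnP (g 0 i)) => ->; rewrite ?opprK; [right|left].
have alpha_norm i : `|alpha 0 i| = 1 by case: (alphaP i) => ->; rewrite ?normrN1 ?normr1.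
have alpha_xs i : xs 0 i = alpha 0 i * `|xs 0 i|.
  rewrite mxE; case: eqP => /= [->|_]; last exact: sgn_norm.
  by rewrite normr0 mulr0.
have indic1 x : Omega (vabs x) -> indic_ext R Omega (vabs x) = 0%E.
  by move=> Ox; rewrite /indic_ext mem_set.
(* A point [v] of [Omega] equals its own absolute value, so the objective is finite at [v] and
   cannot be infinite at the minimizer. *)
have Oxs : Omega (vabs xs).
  have [v Ov] := Omega_nonempty HAc.
  have vv : vabs v = v.
    by apply/rowP => i; rewrite mxE ger0_norm// (Omega_ge0 HAc Ov).
  have := xs_min v I; rewrite /objective (indic1 v) ?vv// /indic_ext.
  by case: ifPn => [/set_mem//|_]; rewrite adde0.
have min_flip x : Omega (vabs x) ->
    f xs + lambda * \sum_i psi `|xs 0 i| <= f x + lambda * \sum_i psi `|x 0 i|.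
  move=> Ox; have := xs_min x I.
  by rewrite /objective !indic1// !adde0 lee_fin.
pose ys i := psi `|xs 0 i|; pose D i := rderive phi (ys i).
have [K /choice[d Kd]] :=
  choice (fun i => phi_taylor HAa HAb (psi_ge0 HAa (normr_ge0 (xs 0 i)))).
(* The first summand is the Taylor error of [phi] weighted by the gradient; the second is the
   quadratic term of [descent_bound], where [|D i| + K i * d i] bounds the ratio of the increments
   of [phi] and of its argument. All of it depends on [xs] only. *)
pose P := \sum_i (`|g 0 i| * K i + n%:R * Lf * (`|D i| + K i * d i) ^+ 2).
have d0 i : 0 < d i by case: (Kd i).
have [eta eta0 etaP] := quadratic_penalty
  (fun i => lambda + alpha 0 i * g 0 i * D i) P d0.
exists eta, alpha; split => //.
- by move=> i xi; rewrite mxE xi.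
- by move=> i xi gi; rewrite mxE xi eqxx.
split => // x /= Ox.
pose e i := psi `|x 0 i| - ys i.
pose r i := phi (psi `|x 0 i|) - phi (ys i).
pose z := \row_i (alpha 0 i * `|x 0 i|).
have z_norm i : `|z 0 i| = `|x 0 i| by rewrite mxE normrM alpha_norm mul1r normr_id.
have Oz : Omega (vabs z).
  by suff -> : vabs z = vabs x by []; apply/rowP => i; rewrite !(mxE map_mx_key) z_norm.
have zE i : (z - xs) 0 i = alpha 0 i * r i.
  have -> : (z - xs) 0 i = z 0 i - xs 0 i by rewrite !mxE.
  rewrite [in X in _ - X]alpha_xs [z 0 i]mxE -mulrBr /r /ys.
  by rewrite !(psiK HAb) ?qualifE/=.
have taylor : (forall i, `|e i| < d i) ->
    0 <= \sum_i (lambda + alpha 0 i * g 0 i * D i) * e i + P * \sum_i e i ^+ 2.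
  move=> near_e.
  have := min_flip z Oz; under [in leRHS]eq_bigr do rewrite z_norm.
  have := descent_bound xs (z - xs) (ltW Lf_gt0) f_diff f_lip.
  rewrite addrC subrK => fz Fz.
  (* Lets a sum of squares with nonnegative weights be bounded by the total weight [P] times the sum
     of all squares. *)
  have e2_le i : e i ^+ 2 <= \sum_j e j ^+ 2.
    by rewrite (bigD1 i)//= lerDl; apply: sumr_ge0 => j _; exact: sqr_ge0.
  have coord i : g 0 i * (alpha 0 i * r i) + n%:R * Lf * (alpha 0 i * r i) ^+ 2
      <= alpha 0 i * g 0 i * D i * e i
         + (`|g 0 i| * K i + n%:R * Lf * (`|D i| + K i * d i) ^+ 2) * e i ^+ 2.
    have [Ki0 di0 /(_ _ (psi_ge0 HAa (normr_ge0 (x 0 i))) (near_e i))] := Kd i.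
    rewrite -/(ys i) -/(D i) -/(e i) -/(r i) => ri.
    (* Split [r i] into [D i * e i] and the Taylor remainder; one factor [|e i|] of the remainder
       bound is replaced by [d i]. *)
    have r_le : `|r i| <= (`|D i| + K i * d i) * `|e i|.
      rewrite -[r i](subrK (D i * e i)) (le_trans (ler_normD _ _))// normrM.
      rewrite addrC mulrDl lerD2l (le_trans ri)//.
      rewrite -(real_normK (num_real (e i))) expr2 mulrA ler_wpM2r// ler_wpM2l//.
      exact/ltW/near_e.
    have r2_le : r i ^+ 2 <= (`|D i| + K i * d i) ^+ 2 * e i ^+ 2.
      rewrite -(real_normK (num_real (e i))) -(real_normK (num_real (r i))) -exprMn.
      by rewrite lerXn2r ?nnegrE// mulr_ge0// addr_ge0// mulr_ge0// ltW.
    have g_le : g 0 i * (alpha 0 i * (r i - D i * e i)) <= `|g 0 i| * K i * e i ^+ 2.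
      rewrite (le_trans (ler_norm _))// !normrM alpha_norm mul1r -mulrA.
      exact: ler_wpM2l.
    have -> : (alpha 0 i * r i) ^+ 2 = r i ^+ 2.
      by rewrite exprMn; case: (alphaP i) => ->; rewrite ?sqrrN expr1n mul1r.
    have nL : 0 <= n%:R * Lf by rewrite mulr_ge0// ltW.
    have := ler_wpM2l nL r2_le; lra.
  have : \sum_i (g 0 i * (z - xs) 0 i) + n%:R * Lf * \sum_i (z - xs) 0 i ^+ 2
      <= \sum_i (alpha 0 i * g 0 i * D i * e i) + P * \sum_i e i ^+ 2.
    rewrite /P mulr_suml mulr_sumr -!big_split/=; apply: ler_sum => i _.
    rewrite zE (le_trans (coord i))// lerD2l ler_wpM2l//.
    have [Ki0 di0 _] := Kd i.
    by rewrite addr_ge0// mulr_ge0 ?sqr_ge0// mulr_ge0// ltW.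
  (* The [lambda] part of the linear term is exactly the change in the regularizer, which the
     minimality of [xs] against [z] controls. *)
  have -> : \sum_i (lambda + alpha 0 i * g 0 i * D i) * e i
      = lambda * (\sum_i psi `|x 0 i| - \sum_i psi `|xs 0 i|)
        + \sum_i (alpha 0 i * g 0 i * D i * e i).
    by rewrite -sumrB mulr_sumr -big_split/=; apply: eq_bigr => i _; rewrite mulrDl.
  by move: fz Fz; rewrite -/g; lra.
(* The penalty vanishes at [xs]; subtracting the two objective values leaves the expression in [e]
   bounded by [etaP]. *)
rewrite subrr [enorm 0 ^+ 2]enorm_sqr [in leLHS]big1 => [|i _]; last first.
  by rewrite mxE expr0n.
rewrite mulr0 add0r -subr_ge0 -addrA -sumrB enorm_sqr.
have := etaP e taylor; congr (is_true (0 <= _ * _ + _));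
  apply: eq_bigr => i _; first by rewrite !mxE.
by rewrite -mulrBr.
Qed.
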